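(* Let $\mu>0$ be real, $r,s\ge1$, let $a_1,\dots,a_r,b_1,\dots,b_s,\alpha,\beta,z\in\mathbb{C}$ satisfy the standing assumption of the context, let $u,w>0$, and assume that the series ${}_rR_{s,q}(a_1,\dots,a_r;b_1,\dots,b_s;\alpha,\beta;zu/w)$ and the series on the right below converge absolutely. Then $$\mathbf{N}_q\left\{t^{\mu-1}\,{}_rR_{s,q}(a_1,\dots,a_r;b_1,\dots,b_s;\alpha,\beta;zt);(u;w)\right\}=\frac{\Gamma_q(\mu)(1-q)^{\mu-1}u^{\mu-1}}{w^\mu}\;{}_{r+1}R_{s+1,q}\left(a_1,\dots,a_r,q^\mu;b_1,\dots,b_s,0;\alpha,\beta;\frac{zu}{w}\right).$$
   Context: Let $0<q<1$. $(a;q)_0=1$, $(a;q)_n=\prod_{i=0}^{n-1}(1-aq^i)$ for $n\ge1$, $(a;q)_\infty=\prod_{i\ge0}(1-aq^i)$. $\Gamma_q(x)=\frac{(q;q)_\infty}{(q^x;q)_\infty}(1-q)^{1-x}$ (principal powers), with $1/\Gamma_q(x)$ read as $0$ at its poles. The basic function ${}_rR_{s,q}$ is $${}_rR_{s,q}(a_1,\dots,a_r;b_1,\dots,b_s;\alpha,\beta;z)=\sum_{\ell=0}^\infty\frac{z^\ell(-1)^{(1+s-r)\ell}q^{(1+s-r)\binom{\ell}{2}}}{(q;q)_\ell\,\Gamma_q(\ell\alpha+\beta)}\,\frac{\prod_{i=1}^r(a_i;q)_\ell}{\prod_{j=1}^s(b_j;q)_\ell}.$$ Standing assumption: $a_iq^\ell\ne1$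 and $b_jq^\ell\neq1$ for all $i,j$ and all integers $\ell\ge0$. The Jackson integral is $\int_0^xf(t)\,\mathrm{d}_qt=(1-q)x\sum_{n\ge0}q^nf(xq^n)$. The $q$-Natural transform (of the first kind) is $$\mathbf{N}_q\{f(t);(u;w)\}=\frac{1}{(1-q)u}\int_0^{u/w}f(t)\left(\tfrac{qwt}{u};q\right)_\infty\mathrm{d}_qt\qquad(u,w>0).$$ *)

(* Defs.v *)
From HB Require Import structures.
From mathcomp Require Export all_boot all_order all_algebra.
From mathcomp Require Export complex.
From mathcomp Require Export all_classical all_reals all_analysis.
Export Order.TTheory GRing.Theory Num.Theory.
Export numFieldNormedType.Exports.

Set Implicit Arguments.
Unset Strict Implicit.
Unset Printing Implicit Defensive.

Global Open Scope ring_scope.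
Global Open Scope complex_scope.

(* Real-closed's R[i] comes without a topology: give it the one that any
   numFieldType K carries on its regular module K^o, i.e. the metric topology
   of the complex modulus. *)
HB.instance Definition _ (R : rcfType) := NormedModule.copy R[i] (R[i])^o.

Section QFunctions.
Variables (R : realType) (q : R).
Implicit Types (x z a alpha beta : R[i]) (f : R -> R[i]) (t u w : R).

(* Principal power p ^ x = exp (x ln p) of a real base p > 0, written out as
   p ^ (Re x) * exp (i * Im x * ln p). *)
Definition cpow (p : R) x : R[i] :=
  (p `^ complex.Re x)%:C *
  (cos (complex.Im x * ln p) +i* sin (complex.Im x * ln p)).

Definition qpoch a (n : nat) : R[i] := \prod_(i < n) (1 - a * q%:C ^+ i).

Definition qpoch_inf a : R[i] := limn (qpoch a).

(* At a pole of Gamma_q the factor qpoch_inf (q ^ x) vanishes; since 0^-1 = 0,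
   both qGamma x and (qGamma x)^-1 are then 0, so that (qGamma x)^-1 is the
   usual entire function 1 / Gamma_q everywhere. *)
Definition qGamma x : R[i] :=
  qpoch_inf q%:C / qpoch_inf (cpow q x) * cpow (1 - q) (1 - x).

(* The exponent 1 + s - r is an integer, possibly negative. *)
Definition qR_term (r s : nat) (a : r.-tuple R[i]) (b : s.-tuple R[i])
    alpha beta z (l : nat) : R[i] :=
  let d : int := (1 + s)%:Z - r%:Z in
  z ^+ l * (-1) ^ (d * l%:Z) * q%:C ^ (d * 'C(l, 2)%:Z)
    / (qpoch q%:C l * qGamma (l%:R * alpha + beta))
    * (\prod_(i < r) qpoch (tnth a i) l / \prod_(j < s) qpoch (tnth b j) l).

Definition qR_abs_cvg (r s : nat) (a : r.-tuple R[i]) (b : s.-tuple R[i])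
    alpha beta z : Prop :=
  cvgn [normed series (qR_term a b alpha beta z)].

Definition qR (r s : nat) (a : r.-tuple R[i]) (b : s.-tuple R[i])
    alpha beta z : R[i] :=
  limn (series (qR_term a b alpha beta z)).

Definition jackson_term f (x : R) (n : nat) : R[i] :=
  (q ^+ n)%:C * f (x * q ^+ n).

(* The Jackson integral over [0, x]; [jackson_cvg] says that it exists. *)
Definition jackson_cvg f (x : R) : Prop := cvgn (series (jackson_term f x)).

Definition jackson f (x : R) : R[i] :=
  ((1 - q) * x)%:C * limn (series (jackson_term f x)).

Definition qNatural_integrand f u w t : R[i] :=
  f t * qpoch_inf (q * w * t / u)%:C.

Definition qNatural_cvg f u w : Prop :=
  jackson_cvg (qNatural_integrand f u w) (u / w).

Definition qNatural f u w : R[i] :=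
  (((1 - q) * u)^-1)%:C * jackson (qNatural_integrand f u w) (u / w).

End QFunctions.

(* Main.v *)
Require Import Defs.
From mathcomp Require Import ring.

(** Write [x = u / w] and let [A l] be the terms of the series R at [z * x].  On
    the Jackson nodes [x * q ^+ n] the kernel is
    [(q^(n+1);q)_oo = (q;q)_oo / (q;q)_n], and replacing [z * x] by
    [z * x * q ^+ n] multiplies [A l] by [q ^+ (n * l)].  Up to the constant
    [x `^ (mu - 1) * (q;q)_oo], the transform is therefore the double sum
    [\sum_n \sum_l A l * (q^(mu+l)) ^+ n / (q;q)_n].

    It is dominated by [|A l| * (q^mu) ^+ n / (q;q)_n], a product of two
    summable families, so the sums can be exchanged ([series_exchange]).  The
    sum over [n] is then given by Euler's identity
    [\sum_n y ^+ n / (q;q)_n = 1 / (y;q)_oo] ([euler_identity]) at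
    [y = q^(mu+l)], and equals [(q^mu;q)_l / (q^mu;q)_oo].  The factor
    [(q^mu;q)_l] is the additional upper parameter of the series on the right
    (the additional lower parameter [0] contributes [(0;q)_l = 1]), while
    [(q;q)_oo / (q^mu;q)_oo] is [Gamma_q mu * (1 - q) `^ (mu - 1)].

    Euler's identity comes from the functional equation
    [(1 - y) * F y = F (y * q)] of its left-hand side [F] and [F y --> 1] as
    [y --> 0].  Limits in [R[i]] are reduced to limits in [R] through the real
    and imaginary parts. *)

Local Open Scope classical_set_scope.

(** * Series of complex numbers *)

Section ComplexSeries.
Set Implicit Arguments.
Unset Strict Implicit.
Unset Printing Implicit Defensive.
Variable R : realType.
Implicit Types (f : nat -> R[i]) (g h : nat -> R) (l x : R[i]).

Let normc := @ComplexField.Normc.normc R.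

Lemma normc_ge0 x : 0 <= normc x.
Proof. by rewrite -lecR; exact: (normr_ge0 x). Qed.

Lemma normc_real (t : R) : normc t%:C = `|t|.
Proof. by rewrite /normc /= expr0n addr0 sqrtr_sqr. Qed.

Lemma normr_Re_le x : `|complex.Re x| <= normc x.
Proof. by case: x => s t; rewrite -sqrtr_sqr ler_wsqrtr// lerDl sqr_ge0. Qed.

Lemma normr_Im_le x : `|complex.Im x| <= normc x.
Proof. by case: x => s t; rewrite -sqrtr_sqr ler_wsqrtr// lerDr sqr_ge0. Qed.

Lemma normc_le_ReIm x : normc x <= `|complex.Re x| + `|complex.Im x|.
Proof.
case: x => s t; rewrite -(ler_pXn2r (n:=2)) ?nnegrE ?addr_ge0 ?sqrtr_ge0//.
rewrite sqr_sqrtr ?addr_ge0 ?sqr_ge0// sqrrD !real_normK ?num_real//.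
by rewrite lerD2r lerDl mulrn_wge0// mulr_ge0.
Qed.

Lemma cvg_complexP f l : f @ \oo --> l <->
  (fun n => complex.Re (f n)) @ \oo --> complex.Re l /\
  (fun n => complex.Im (f n)) @ \oo --> complex.Im l.
Proof.
split=> [/cvgrPdist_lt fl|[/cvgrPdist_lt fr /cvgrPdist_lt fi]].
  split; apply/cvgrPdist_lt => e e0;
    have eC : 0 < e%:C by [rewrite ltcR];
    apply: filterS (fl _ eC) => n; rewrite ltcR => h; apply: le_lt_trans h;
    rewrite -raddfB.
  - exact: normr_Re_le.
  - exact: normr_Im_le.
apply/cvgrPdist_lt => e e0.
have eE : e = (complex.Re e)%:C by apply/esym/RRe_real; exact: gtr0_real.
have re0 : 0 < complex.Re e / 2.
  by move: e0; rewrite {1}eE ltcR => ?; rewrite divr_gt0.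
apply: filterS2 (fr _ re0) (fi _ re0) => n hr hi.
rewrite eE ltcR; apply: le_lt_trans (normc_le_ReIm _) _; rewrite !raddfB /=.
by rewrite [ltRHS]splitr ltrD.
Qed.

Lemma limn_complexE f l : f @ \oo --> l -> limn f = l.
Proof. by move=> fl; exact: (cvg_lim _ fl). Qed.

Lemma cvg_real_complex g (t : R) :
  g @ \oo --> t -> (fun n => (g n)%:C) @ \oo --> t%:C.
Proof. by move=> gt; apply/cvg_complexP; split => //=; exact: cvg_cst. Qed.

Lemma series_Re f n :
  series (fun k => complex.Re (f k)) n = complex.Re (series f n).
Proof. by rewrite /series/= (raddf_sum (@complex.Re R : Rcomplex R -> R)). Qed.

Lemma series_Im f n :
  series (fun k => complex.Im (f k)) n = complex.Im (series f n).
Proof. by rewrite /series/= (raddf_sum (@complex.Im R : Rcomplex R -> R)). Qed.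

Lemma cvg_series_normc f :
  cvgn (series (fun n => normc (f n))) -> cvgn (series f).
Proof.
move=> fn.
have part (p : R[i] -> R) : (forall x, `|p x| <= normc x) ->
    cvgn (series (fun n => p (f n))).
  move=> pn; apply: (@normed_cvg R R^o).
  by apply: series_le_cvg fn => n //=; exact: normc_ge0.
have /cvg_ex[a fa] := part _ normr_Re_le.
have /cvg_ex[b fb] := part _ normr_Im_le.
apply/cvg_ex; exists (a +i* b); apply/cvg_complexP; split => /=.
  by under eq_cvg do rewrite -series_Re.
by under eq_cvg do rewrite -series_Im.
Qed.

(** In [R[i]] the norm takes complex values, so that absolute convergence as
    stated by [ [normed _] ] concerns a complex sequence; this transports it to
    a real one, where the comparison tests apply. *)
Lemma normed_series_cvg_normc f :
  cvgn [normed series f] -> cvgn (series (fun n => normc (f n))).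
Proof.
move=> /cvg_ex[l /cvg_complexP[fl _]]; apply/cvg_ex; exists (complex.Re l).
by rewrite (_ : series _ = (fun n => complex.Re ([normed series f] n)))//;
  apply/funext => n; rewrite -series_Re.
Qed.

Lemma normc_lim_le f l (c : R) :
  f @ \oo --> l -> (forall n, normc (f n) <= c) -> normc l <= c.
Proof.
move=> /cvg_norm/cvg_complexP[fl _] fc.
rewrite -[normc l](cvg_lim _ fl)//; apply: limr_le; first exact: cvgP fl.
by near=> n; exact: fc.
Unshelve. all: by end_near. Qed.

Lemma dominated_series_tail h g : (forall n, `|h n| <= g n) ->
  cvgn (series g) -> cvgn (series h) /\
  forall N, `|limn (series h) - series h N| <= limn (series g) - series g N.
Proof.
move=> hg cg.
have g0 n : 0 <= g n by exact: le_trans (hg n).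
have ch : cvgn (series h).
  by apply: (@normed_cvg R R^o); apply: series_le_cvg cg => n //=.
split=> // N.
have cN : (fun n => `|series h n - series h N|) @ \oo -->
    `|limn (series h) - series h N|.
  by apply: cvg_norm; apply: cvgB => //; exact: cvg_cst.
rewrite -(cvg_lim _ cN)//; apply: limr_le; first exact: cvgP cN.
near=> n.
have Nn : (N <= n)%N by near: n; exact: nbhs_infty_ge.
rewrite sub_series_geq// (le_trans (ler_norm_sum _ _ _))//.
apply: (@le_trans _ _ (series g n - series g N)).
  by rewrite sub_series_geq//; exact: ler_sum.
rewrite lerB// nondecreasing_cvgn_le//.
by apply: nondecreasing_series => m _ _; exact: g0.
Unshelve. all: by end_near. Qed.

Lemma cvg_series_mulr_bounded (A : nat -> R[i]) (k : nat -> R) (c : R) :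
  cvgn (series (fun j => normc (A j))) -> (forall j, `|k j| <= c) ->
  cvgn (series (fun j => A j * (k j)%:C)).
Proof.
move=> cA kc; apply: cvg_series_normc.
apply: (@series_le_cvg _ _ (fun j => c * normc (A j))) => [j|j|j|].
- exact: normc_ge0.
- by rewrite mulr_ge0 ?normc_ge0// (le_trans _ (kc j)).
- rewrite [leLHS](ComplexField.Normc.normcM (A j)) [X in _ * X]normc_real.
  by rewrite mulrC ler_wpM2r// normc_ge0.
- exact: (is_cvg_seriesZ (V := R^o)).
Qed.

Lemma cvg_mull_complex (c : R[i]) f l :
  f @ \oo --> l -> (fun n => c * f n) @ \oo --> c * l.
Proof. by move=> fl; exact: (cvgZl_tmp fl). Qed.

(** Interchange of the two summations for a double series dominated by a
    product [normc (A j) * g n].  The first [N] outer terms can be summed inside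
    by linearity; what is left out has norm at most the tail of the series [g]
    times the sum of the [normc (A j)], uniformly in [j], hence tends to [0]. *)
Lemma series_exchange (A : nat -> R[i]) (h : nat -> nat -> R) g :
  (forall n j, `|h n j| <= g n) -> cvgn (series g) ->
  cvgn (series (fun j => normc (A j))) ->
  series (fun n => limn (series (fun j => A j * (h n j)%:C))) @ \oo -->
  limn (series (fun j => A j * (limn (series (h ^~ j)))%:C)).
Proof.
move=> hg cg cA.
have tail j := dominated_series_tail (hg^~ j) cg.
pose H j := limn (series (h ^~ j)).
pose HN N j := series (h ^~ j) N.
pose L n := limn (series (fun j => A j * (h n j)%:C)).
pose G := limn (series g).
have HG N j : `|H j - HN N j| <= G - series g N := (tail j).2 N.
have cH : cvgn (series (fun j => A j * (H j)%:C)).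
  apply: (@cvg_series_mulr_bounded _ _ G) => // j.
  by have := HG 0%N j; rewrite /HN /series/= !big_geq// !subr0.
have cHN N : series (fun j => A j * (HN N j)%:C) @ \oo --> series L N.
  elim: N => [|N IH].
    have -> : series L 0 = 0 by rewrite /series/= big_geq.
    have -> : series (fun j => A j * (HN 0%N j)%:C) = cst 0.
      apply/funext => m; rewrite /series/= big1// => j _.
      by rewrite /HN /series/= big_geq// mulr0.
    exact: cvg_cst.
  have ch := cvg_series_mulr_bounded cA (hg N).
  rewrite seriesSr (_ : series (fun j => A j * (HN N.+1 j)%:C) =
    (fun m => series (fun j => A j * (HN N j)%:C) m +
              series (fun j => A j * (h N j)%:C) m)); first exact: cvgD IH ch.
  apply/funext => m; rewrite /series/= -big_split/=; apply: eq_bigr => j _.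
  by rewrite -mulrDr -rmorphD /HN seriesSr.
pose M := limn (series (fun j => normc (A j))).
have bound N : normc (limn (series (fun j => A j * (H j)%:C)) -
    series L N) <= M * (G - series g N).
  have cD : (fun m => series (fun j => A j * (H j)%:C) m -
      series (fun j => A j * (HN N j)%:C) m) @ \oo -->
      limn (series (fun j => A j * (H j)%:C)) - series L N.
    exact: (cvgB cH (cHN N)).
  apply: (normc_lim_le cD) => m.
  have -> : series (fun j => A j * (H j)%:C) m -
      series (fun j => A j * (HN N j)%:C) m =
      \sum_(0 <= j < m) A j * (H j - HN N j)%:C.
    rewrite -sumrB; apply: eq_bigr => j _.
    by rewrite -mulrBr -rmorphB.
  apply: (@le_trans _ _ (\sum_(0 <= j < m) normc (A j * (H j - HN N j)%:C))).
    elim/big_ind2: _ => [|x1 y1 x2 y2 h1 h2|//].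
      by rewrite normc_real normr0.
    exact: le_trans (le_normcD _ _) (lerD _ _).
  apply: (@le_trans _ _ (series (fun j => normc (A j)) m * (G - series g N))).
    rewrite /series/= mulr_suml; apply: ler_sum => j _.
    rewrite [leLHS](ComplexField.Normc.normcM (A j)) [X in _ * X]normc_real.
    by rewrite ler_wpM2l// normc_ge0.
  rewrite ler_wpM2r//; first exact: le_trans (HG N 0%N).
  rewrite nondecreasing_cvgn_le//.
  by apply: nondecreasing_series => j _ _; exact: normc_ge0.
have b0 : (fun N => M * (G - series g N)) @ \oo --> (0 : R).
  rewrite -[0](mulr0 M) -(subrr G); apply: cvgMl_tmp; apply: cvgB => //.
  exact: cvg_cst.
apply/cvgrPdist_lt => e e0.
have eE : e = (complex.Re e)%:C by apply/esym/RRe_real; exact: gtr0_real.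
have re0 : 0 < complex.Re e by move: e0; rewrite {1}eE ltcR.
move/cvgrPdist_lt: b0 => /(_ _ re0); apply: filterS => N.
rewrite sub0r normrN => hN; rewrite eE ltcR.
exact: le_lt_trans (bound N) (le_lt_trans (ler_norm _) hN).
Qed.

End ComplexSeries.

(** * Infinite q-products and Euler's identity *)

Section QPochhammer.
Set Implicit Arguments.
Unset Strict Implicit.
Unset Printing Implicit Defensive.
Variables (R : realType) (q : R).

Definition qpochR (a : R) (n : nat) : R := \prod_(i < n) (1 - a * q ^+ i).

Definition euler_term (x : R) (n : nat) : R := x ^+ n / qpochR q n.

Hypotheses (q0 : 0 < q) (q1 : q < 1).
Implicit Types (a x y : R) (n k N : nat).

Lemma qpoch_real a n : qpoch q a%:C n = (qpochR a n)%:C.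
Proof.
rewrite /qpoch /qpochR rmorph_prod/=; apply: eq_bigr => i _.
by rewrite rmorphB rmorphM rmorphXn.
Qed.

Lemma qpochRS a n : qpochR a n.+1 = qpochR a n * (1 - a * q ^+ n).
Proof. by rewrite /qpochR big_ord_recr. Qed.

Lemma qpochRD a m n :
  qpochR a (m + n) = qpochR a m * qpochR (a * q ^+ m) n.
Proof.
rewrite /qpochR big_split_ord/=; congr (_ * _).
by apply: eq_bigr => i _; rewrite exprD mulrA.
Qed.

Lemma qpochR_factor_ge0 a n : a <= 1 -> 0 <= 1 - a * q ^+ n.
Proof.
move=> a1; rewrite subr_ge0 (@le_trans _ _ (q ^+ n))//.
  by rewrite ler_piMl// exprn_ge0// ltW.
by rewrite exprn_ile1// ltW.
Qed.

Lemma qpochR_ge0 a n : a <= 1 -> 0 <= qpochR a n.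
Proof. by move=> a1; apply: prodr_ge0 => i _; exact: qpochR_factor_ge0. Qed.

Lemma qpochR_gt0 a n : 0 <= a < 1 -> 0 < qpochR a n.
Proof.
move=> /andP[a0 a1]; apply: prodr_gt0 => i _.
rewrite subr_gt0 (le_lt_trans _ a1)// ler_piMr// exprn_ile1// ltW//.
Qed.

Lemma qpochR_cvg a : 0 <= a <= 1 -> cvgn (qpochR a).
Proof.
move=> /andP[a0 a1]; apply: nonincreasing_is_cvgn.
  apply/nonincreasing_seqP => n; rewrite qpochRS ler_piMr ?qpochR_ge0//.
  by rewrite lerBlDr lerDl mulr_ge0// exprn_ge0// ltW.
by exists 0 => _ [n _ <-]; exact: qpochR_ge0.
Qed.

Lemma qpoch_inf_real a : 0 <= a <= 1 ->
  qpoch_inf q a%:C = (limn (qpochR a))%:C.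
Proof.
move=> a01; apply/cvg_lim => //.
under eq_cvg do rewrite qpoch_real.
exact: cvg_real_complex (qpochR_cvg a01).
Qed.

Lemma qpochR_inf_split a k : 0 <= a <= 1 ->
  limn (qpochR a) = qpochR a k * limn (qpochR (a * q ^+ k)).
Proof.
move=> a01; have /andP[a0 a1] := a01; apply/cvg_lim => //.
rewrite -(cvg_shiftn k) (_ : [sequence _]_n =
  (fun n => qpochR a k * qpochR (a * q ^+ k) n)); last first.
  by apply/funext => n /=; rewrite addnC qpochRD.
apply: cvgMl_tmp; apply: qpochR_cvg.
apply/andP; split; first by rewrite mulr_ge0// exprn_ge0// ltW.
by rewrite mulr_ile1 ?exprn_ge0 ?exprn_ile1// ltW.
Qed.

Lemma euler_term_ge0 x n : 0 <= x -> 0 <= euler_term x n.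
Proof.
by move=> x0; rewrite divr_ge0 ?exprn_ge0// qpochR_ge0// ltW.
Qed.

(** The coefficients of the series satisfy
    [(1 - q ^+ n.+1) / (q;q)_n.+1 = 1 / (q;q)_n], which is what makes the
    difference between the values at [x] and [x * q] a shifted copy. *)
Lemma euler_series_functional x N :
  series (euler_term x) N.+1 - series (euler_term (x * q)) N.+1 =
  x * series (euler_term x) N.
Proof.
rewrite /series/= -sumrB big_nat_recl//= /euler_term !expr0 subrr add0r.
rewrite mulr_sumr; apply: eq_bigr => n _.
have qn0 : qpochR q n != 0 by rewrite gt_eqF// qpochR_gt0// ltW.
have qS0 : 1 - q * q ^+ n != 0.
  by rewrite gt_eqF// subr_gt0 -exprS exprn_ilt1// ltW.
by rewrite qpochRS exprMn !exprS; field; rewrite qn0.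
Qed.

Lemma nondecreasing_euler_series x : 0 <= x ->
  nondecreasing_seq (series (euler_term x)).
Proof.
by move=> x0; apply: nondecreasing_series => n _ _; exact: euler_term_ge0.
Qed.

(** The functional equation iterated on partial sums: the off-by-one index in
    [euler_series_functional] only costs an inequality, because the partial sums
    increase. *)
Lemma euler_series_scale_le x k N : 0 <= x < 1 ->
  series (euler_term x) N * qpochR x k <=
  series (euler_term (x * q ^+ k)) N.
Proof.
move=> /andP[x0 x1].
elim: k => [|k IH]; first by rewrite /qpochR big_ord0 expr0 !mulr1.
rewrite qpochRS mulrA exprSr mulrA.
set y := x * q ^+ k in IH *.
have y0 : 0 <= y by rewrite mulr_ge0// exprn_ge0// ltW.
have y1 : y <= 1 by rewrite mulr_ile1 ?exprn_ge0 ?exprn_ile1 ?(ltW x1)// ltW.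
apply: (le_trans (ler_wpM2r _ IH)); first by rewrite subr_ge0.
case: N {IH} => [|N]; first by rewrite /series/= !big_geq// mul0r.
rewrite mulrBr mulr1 lerBlDr -lerBlDl euler_series_functional mulrC.
by rewrite ler_wpM2r//; apply: nondecreasing_euler_series.
Qed.

(** Since [(q;q)_n >= (1 - q) ^+ n], the partial sums are bounded by those of a
    geometric series as long as [x <= (1 - q) / 2]; the functional equation
    carries a bound near [0] to the whole of [ [0, 1[ ]. *)
Lemma euler_series_cvg x : 0 <= x < 1 -> cvgn (series (euler_term x)).
Proof.
move=> x01; have /andP[x0 x1] := x01.
have small y N : 0 <= y <= (1 - q) / 2 -> series (euler_term y) N <= 2.
  move=> /andP[y0 yq].
  have q1' : 0 < 1 - q by rewrite subr_gt0.
  apply: (@le_trans _ _ (series (geometric 1 (2^-1)) N)); last first.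
    apply: le_trans (geometric_le_lim _ _ _ _) _ => //.
      by rewrite gtr0_norm// invf_lt1// ltr1n.
    by rewrite le_eqVlt; apply/orP; left; apply/eqP; field.
  apply: ler_sum => n _; rewrite /euler_term /geometric/= mul1r.
  rewrite ler_pdivrMr ?qpochR_gt0 ?(ltW q0)//.
  apply: (@le_trans _ _ (2^-1 ^+ n * (1 - q) ^+ n)).
    rewrite -exprMn; apply: lerXn2r; rewrite ?nnegrE//.
      by rewrite mulr_ge0 ?invr_ge0// ltW.
    by rewrite mulrC.
  rewrite ler_wpM2l ?exprn_ge0// /qpochR -[n in (1 - q) ^+ n]card_ord.
  rewrite -prodr_const; apply: ler_prod => i _.
  by rewrite ltW//= lerB// ler_piMr ?exprn_ile1// ltW.
have [k xk] : exists k, x * q ^+ k <= (1 - q) / 2.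
  have /cvgrPdist_le : (fun k => q ^+ k) @ \oo --> 0.
    by apply: cvg_expr; rewrite ger0_norm// ltW.
  have e0 : 0 < (1 - q) / 2 by rewrite divr_gt0// subr_gt0.
  move=> /(_ _ e0)[k _ /(_ k (leqnn k))]; rewrite sub0r normrN.
  rewrite ger0_norm ?exprn_ge0 ?(ltW q0)// => qk; exists k.
  by apply: le_trans qk; rewrite ler_piMl ?exprn_ge0// ltW.
apply: nondecreasing_is_cvgn; first exact: nondecreasing_euler_series.
exists (2 / qpochR x k) => _ [N _ <-].
rewrite ler_pdivlMr ?qpochR_gt0//.
apply: le_trans (euler_series_scale_le _ _ x01) (small _ _ _).
by rewrite xk mulr_ge0// exprn_ge0// ltW.
Qed.

(** Every term but the constant one gains a factor at most [q ^+ k], which gives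
    the limit [1] at [0] with an explicit rate. *)
Lemma euler_series_near0 x k N : 0 <= x ->
  series (euler_term (x * q ^+ k)) N <= 1 + q ^+ k * series (euler_term x) N.
Proof.
move=> x0; case: N => [|N].
  by rewrite /series/= !big_geq// mulr0 addr0 ler01.
rewrite /series/= big_nat_recl//= {1}/euler_term /qpochR big_ord0 expr0 divr1.
rewrite lerD2l mulr_sumr [leRHS]big_nat_recl//=.
apply: (@le_trans _ _ (\sum_(0 <= i < N) q ^+ k * euler_term x i.+1)).
  apply: ler_sum => i _; rewrite /euler_term mulrA exprMn.
  rewrite ler_wpM2r ?invr_ge0 ?qpochR_ge0 ?(ltW q1)// mulrC.
  rewrite ler_wpM2r ?exprn_ge0// -exprM mulnS exprD.
  by rewrite ler_piMr ?exprn_ge0 ?exprn_ile1 ?(ltW q0) ?(ltW q1).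
by rewrite lerDr mulr_ge0 ?euler_term_ge0// exprn_ge0// ltW.
Qed.

(** Euler's identity: the sum [F x] of the series satisfies
    [(1 - x) * F x = F (x * q)], so that [F x * (x;q)_k = F (x * q ^+ k)], and
    [F] tends to [1] at [0].  The product form gives at the same time that
    [(x;q)_oo] does not vanish. *)
Lemma euler_identity x : 0 <= x < 1 ->
  limn (series (euler_term x)) * limn (qpochR x) = 1.
Proof.
pose F y := limn (series (euler_term y)).
have Fq y : 0 <= y < 1 -> F y * (1 - y) = F (y * q).
  move=> /andP[y0 y1].
  have cy : cvgn (series (euler_term y)) by apply: euler_series_cvg; rewrite y0.
  have cyq : cvgn (series (euler_term (y * q))).
    apply: euler_series_cvg; rewrite mulr_ge0 ?(ltW q0)//=.
    by rewrite mulr_ilt1// ltW.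
  have : F y - F (y * q) = y * F y.
    rewrite -[RHS](cvg_lim _ (cvgMl_tmp (a := y) cy))//; apply/esym/cvg_lim => //.
    under eq_cvg do rewrite -euler_series_functional.
    by apply: cvgB; rewrite cvg_shiftS.
  by move=> /(canRL (subrK _)) h; rewrite mulrBr mulr1 [F y * y]mulrC {1}h; ring.
move=> x01; have /andP[x0 x1] := x01.
have qk0 k : 0 <= x * q ^+ k by rewrite mulr_ge0// exprn_ge0// ltW.
have qk1 k : x * q ^+ k < 1.
  by rewrite (le_lt_trans _ x1)// ler_piMr// exprn_ile1// ltW.
have cF k : cvgn (series (euler_term (x * q ^+ k))).
  by apply: euler_series_cvg; rewrite qk0 qk1.
have Fk k : F x * qpochR x k = F (x * q ^+ k).
  elim: k => [|k IH]; first by rewrite /qpochR big_ord0 expr0 !mulr1.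
  by rewrite qpochRS mulrA IH Fq ?exprSr ?mulrA// qk0 qk1.
have F1 : (fun k => F (x * q ^+ k)) @ \oo --> (1 : R).
  apply: (@squeeze_cvgr _ _ _ _ (cst 1) (fun k => 1 + q ^+ k * F x)).
  - near=> k; apply/andP; split.
      have := nondecreasing_cvgn_le (nondecreasing_euler_series (qk0 k)) (cF k) 1%N.
      by rewrite /series/= big_nat1 /euler_term /qpochR big_ord0 expr0 divr1.
    have cx : cvgn (series (euler_term x)) := euler_series_cvg x01.
    apply: limr_le; first exact: cF.
    near=> N; apply: le_trans (euler_series_near0 k N x0) _.
    rewrite lerD2l ler_wpM2l ?exprn_ge0 ?(ltW q0)//.
    exact: nondecreasing_cvgn_le (nondecreasing_euler_series x0) cx N.
  - exact: cvg_cst.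
  - rewrite -[1 in X in _ --> X]addr0; apply: cvgD; first exact: cvg_cst.
    rewrite -(mul0r (F x)); apply: cvgMr_tmp.
    by apply: cvg_expr; rewrite ger0_norm// ltW.
have x01' : 0 <= x <= 1 by rewrite x0 ltW.
rewrite -(cvg_lim _ (cvgMl_tmp (a := F x) (qpochR_cvg x01')))//; apply/cvg_lim => //.
by under eq_cvg do rewrite Fk.
Unshelve. all: by end_near. Qed.

Lemma qpochR_inf_neq0 x : 0 <= x < 1 -> limn (qpochR x) != 0.
Proof.
move=> x01; apply/eqP => Q0; have := euler_identity x01.
by rewrite Q0 mulr0 => /esym/eqP; rewrite oner_eq0.
Qed.

Lemma euler_sum_shift x k : 0 <= x < 1 ->
  limn (series (euler_term (x * q ^+ k))) = qpochR x k / limn (qpochR x).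
Proof.
move=> x01; have /andP[x0 x1] := x01.
have xk01 : 0 <= x * q ^+ k < 1.
  rewrite mulr_ge0 ?exprn_ge0 ?(ltW q0)//= (le_lt_trans _ x1)//.
  by rewrite ler_piMr// exprn_ile1// ltW.
apply: (mulIf (qpochR_inf_neq0 xk01)); rewrite (euler_identity xk01).
rewrite mulrAC -qpochR_inf_split ?x0 ?(ltW x1)// divff//.
exact: qpochR_inf_neq0.
Qed.

End QPochhammer.

(** * The q-Natural transform of a basic function *)

Section QNatural.
Set Implicit Arguments.
Unset Strict Implicit.
Unset Printing Implicit Defensive.
Variables (R : realType) (q : R).

Lemma cpow_real (p x : R) : cpow p x%:C = (p `^ x)%:C.
Proof. by rewrite /cpow /= mul0r cos0 sin0 [X in _ * X]complexr0 mulr1. Qed.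

Lemma powR_ge0_lt1 (mu : R) : 0 < q < 1 -> 0 < mu -> 0 <= q `^ mu < 1.
Proof.
move=> /andP[q0 q1] mu0; rewrite powR_ge0/= /powR gt_eqF// expR_lt1.
by rewrite pmulr_rlt0// ln_lt0// q0 q1.
Qed.

Lemma powR_subr1 (x mu : R) : 0 < x -> x `^ (mu - 1) = x `^ mu / x.
Proof.
by move=> x0; rewrite powRB ?powRr1 ?(gt_eqF x0) ?implybT ?(ltW x0).
Qed.

Lemma qR_term_scale (r s : nat) (a : r.-tuple R[i]) (b : s.-tuple R[i])
    (alpha beta z : R[i]) (c : R) (l : nat) :
  qR_term q a b alpha beta (z * c%:C) l =
  qR_term q a b alpha beta z l * (c ^+ l)%:C.
Proof. by rewrite /qR_term exprMn rmorphXn/= !(mulrAC _ (c%:C ^+ l)). Qed.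

(** Adding one parameter on each side leaves the exponent [1 + s - r]
    unchanged, and the lower parameter [0] contributes [(0;q)_l = 1]. *)
Lemma qR_term_rcons (r s : nat) (a : r.-tuple R[i]) (b : s.-tuple R[i])
    (alpha beta z c : R[i]) (l : nat) :
  qR_term q [tuple of rcons a c] [tuple of rcons b 0] alpha beta z l =
  qR_term q a b alpha beta z l * qpoch q c l.
Proof.
have tnth_last m (t : m.-tuple R[i]) d : tnth [tuple of rcons t d] ord_max = d.
  by rewrite (tnth_nth 0)/= nth_rcons size_tuple ltnn eqxx.
have tnth_wid m (t : m.-tuple R[i]) d i :
    tnth [tuple of rcons t d] (widen_ord (leqnSn m) i) = tnth t i.
  by rewrite !(tnth_nth 0)/= nth_rcons size_tuple ltn_ord.
have p0 : qpoch q 0 l = 1 by apply: big1 => i _; rewrite mul0r subr0.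
rewrite /qR_term !big_ord_recr/= !tnth_last p0 mulr1.
under eq_bigr do rewrite tnth_wid.
under [\prod_(i < s) _]eq_bigr do rewrite tnth_wid.
have -> : (1 + s.+1)%:Z - r.+1%:Z = (1 + s)%:Z - r%:Z :> int.
  by rewrite addnS -addn1 -[in r.+1]addn1 !PoszD opprD addrACA subrr addr0.
by rewrite (mulrAC (\prod_(i < r) _)) !mulrA.
Qed.

End QNatural.

Theorem theorem15 (R : realType) (q : R) (hq0 : 0 < q) (hq1 : q < 1)
    (mu : R) (hmu : 0 < mu) (r s : nat) (hr : (1 <= r)%N) (hs : (1 <= s)%N)
    (a : r.-tuple R[i]) (b : s.-tuple R[i]) (alpha beta z : R[i])
    (ha : forall (i : 'I_r) (l : nat), tnth a i * q%:C ^+ l != 1)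
    (hb : forall (j : 'I_s) (l : nat), tnth b j * q%:C ^+ l != 1)
    (u w : R) (hu : 0 < u) (hw : 0 < w)
    (hL : qR_abs_cvg q a b alpha beta (z * (u / w)%:C))
    (hR : qR_abs_cvg q [tuple of rcons a (q `^ mu)%:C] [tuple of rcons b 0]
            alpha beta (z * (u / w)%:C)) :
  let f := fun t : R =>
    (t `^ (mu - 1))%:C * qR q a b alpha beta (z * t%:C) in
  qNatural_cvg q f u w /\
  qNatural q f u w =
    qGamma q mu%:C * ((1 - q) `^ (mu - 1) * u `^ (mu - 1) / w `^ mu)%:C
    * qR q [tuple of rcons a (q `^ mu)%:C] [tuple of rcons b 0]
        alpha beta (z * (u / w)%:C).
Proof.
move=> f; set x := u / w.
have x0 : 0 < x by rewrite divr_gt0.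
have qmu01 := powR_ge0_lt1 (introT andP (conj hq0 hq1)) hmu.
have /andP[qmu0 qmu1] := qmu01.
have q01 : 0 <= q <= 1 by rewrite !ltW.
have qmu01' : 0 <= q `^ mu <= 1 by rewrite qmu0 ltW.
pose A := qR_term q a b alpha beta (z * x%:C).
have cA := normed_series_cvg_normc hL.
(* [p l] is [q^(mu+l)], and the [h n l] are the terms of Euler's series at
   [p l]: everything in the double sum but [A l]. *)
pose p n := q `^ mu * q ^+ n.
have p01 l : 0 <= p l < 1.
  rewrite mulr_ge0 ?exprn_ge0 ?(ltW hq0)//= (le_lt_trans _ qmu1)//.
  by rewrite ler_piMr// exprn_ile1// ltW.
pose h n l := euler_term q (p l) n.
pose Qmu := limn (qpochR q (q `^ mu)).
pose Qq := limn (qpochR q q).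
have Qmu0 : Qmu != 0 := qpochR_inf_neq0 hq0 hq1 qmu01.
have hE n l : h n l = h n 0%N * (q ^+ n) ^+ l.
  rewrite /h /euler_term /p expr0 mulr1 exprMn -!exprM [(l * n)%N]mulnC.
  by rewrite mulrAC.
have h0 n : 0 <= h n 0%N.
  by apply: euler_term_ge0 => //; have /andP[] := p01 0%N.
have qn n l : `|(q ^+ n) ^+ l| <= 1.
  by rewrite ger0_norm ?exprn_ge0 ?(ltW hq0)// -exprM exprn_ile1// ltW.
have hdom n l : `|h n l| <= h n 0%N.
  by rewrite hE normrM (ger0_norm (h0 n)) ler_piMr.
have hsum l : limn (series (h ^~ l)) = qpochR q (q `^ mu) l / Qmu.
  exact: euler_sum_shift.
have ch0 : cvgn (series (h ^~ 0%N)) by exact: euler_series_cvg.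
have ex := series_exchange hdom ch0 cA.
pose K := x `^ (mu - 1) * Qq.
have termE n : jackson_term q (qNatural_integrand q f u w) x n =
    K%:C * limn (series (fun l => A l * (h n l)%:C)).
  rewrite /jackson_term /qNatural_integrand /f.
  have -> : q * w * (x * q ^+ n) / u = q * q ^+ n.
    by rewrite /x; field; rewrite !gt_eqF.
  rewrite qpoch_inf_real//; last first.
    apply/andP; split; first by rewrite mulr_ge0// ?exprn_ge0// ltW.
    by rewrite mulr_ile1 ?exprn_ge0 ?exprn_ile1// ltW.
  have cz := cvg_series_mulr_bounded cA (qn n).
  have -> : limn (series (fun l => A l * (h n l)%:C)) =
      (h n 0%N)%:C * qR q a b alpha beta (z * (x * q ^+ n)%:C).
    apply: limn_complexE.
    have -> : series (fun l => A l * (h n l)%:C) = (fun N => (h n 0%N)%:C *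
        series (fun l => A l * ((q ^+ n) ^+ l)%:C) N).
      apply/funext => N; rewrite /series/= mulr_sumr; apply: eq_bigr => l _.
      by rewrite hE rmorphM/= mulrCA.
    apply: cvg_mull_complex; rewrite /qR.
    have -> : qR_term q a b alpha beta (z * (x * q ^+ n)%:C) =
        (fun l => A l * ((q ^+ n) ^+ l)%:C).
      by apply/funext => l; rewrite rmorphM/= mulrA qR_term_scale.
    exact: cz.
  rewrite !mulrA mulrAC -!rmorphM/=; congr (_%:C * _).
  rewrite /K /Qq (qpochR_inf_split hq0 hq1 n q01) /h /euler_term /p expr0 mulr1.
  (* The weight [q ^+ n] of the Jackson node turns [(q ^+ n) `^ (mu - 1)] into
     [(q `^ mu) ^+ n]. *)
  have -> : (x * q ^+ n) `^ (mu - 1) = x `^ (mu - 1) * ((q `^ mu) ^+ n / q ^+ n).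
    rewrite powRM ?exprn_ge0 ?ltW//; congr (_ * _).
    rewrite powR_subr1 ?exprn_gt0//; congr (_ / _).
    by rewrite -!powR_mulrn ?powR_ge0 ?(ltW hq0)// powRAC.
  by field; rewrite expf_neq0 ?gt_eqF// qpochR_gt0// hq1 ltW.
have jcvg : series (jackson_term q (qNatural_integrand q f u w) x) @ \oo -->
    K%:C * limn (series (fun l => A l * (limn (series (h ^~ l)))%:C)).
  have -> : series (jackson_term q (qNatural_integrand q f u w) x) =
      (fun N => K%:C *
        series (fun n => limn (series (fun l => A l * (h n l)%:C))) N).
    apply/funext => N; rewrite /series/= mulr_sumr; apply: eq_bigr => n _.
    exact: termE.
  exact: cvg_mull_complex ex.
have inner : limn (series (fun l => A l * (limn (series (h ^~ l)))%:C)) =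
    (Qmu^-1)%:C * qR q [tuple of rcons a (q `^ mu)%:C] [tuple of rcons b 0]
        alpha beta (z * x%:C).
  apply: limn_complexE.
  have -> : series (fun l => A l * (limn (series (h ^~ l)))%:C) =
      (fun N => (Qmu^-1)%:C * series (qR_term q [tuple of rcons a (q `^ mu)%:C]
         [tuple of rcons b 0] alpha beta (z * x%:C)) N).
    apply/funext => N; rewrite /series/= mulr_sumr; apply: eq_bigr => l _.
    rewrite hsum qR_term_rcons qpoch_real rmorphM/=.
    by rewrite [LHS]mulrA [LHS]mulrC.
  apply: cvg_mull_complex.
  exact: cvg_series_normc (normed_series_cvg_normc hR).
split; first exact: cvgP jcvg.
rewrite /qNatural /jackson (limn_complexE jcvg) inner.
rewrite !mulrA; congr (_ * _).
rewrite /qGamma -[1 - mu%:C](rmorphB (real_complex R)) !cpow_real.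
rewrite !qpoch_inf_real// -fmorphV -!rmorphM/=; congr (_%:C).
have uw1 : x `^ (mu - 1) = u `^ (mu - 1) / w `^ (mu - 1).
  by rewrite /x powRM ?invr_ge0 ?ltW// -powR_inv1 ?ltW// powRAC powR_inv1 ?powR_ge0.
have w1 : w `^ (mu - 1) = w `^ mu / w := powR_subr1 _ hw.
have q1m : (1 - q) `^ (1 - mu) * (1 - q) `^ (mu - 1) = 1.
  by rewrite -(opprB mu 1) powRN mulVf// gt_eqF// powR_gt0// subr_gt0.
rewrite -/Qq -/Qmu /K uw1 w1 /x.
(* [field] does not relate the two powers of [1 - q], so their product is
   isolated first. *)
transitivity (Qq / Qmu * ((1 - q) `^ (1 - mu) * (1 - q) `^ (mu - 1)) *
    (u `^ (mu - 1) / w `^ mu)); last by field; rewrite Qmu0 gt_eqF// powR_gt0.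
rewrite q1m; field.
by rewrite Qmu0 !gt_eqF// ?powR_gt0// subr_gt0.
Qed.
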